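(* Let $\mathbb{K}$ be a commutative ring with identity and let $\mathfrak{g}$ be a Leibniz algebra over $\mathbb{K}$ such that $\mathfrak{g}^{\mathrm{ab}}=\mathfrak{g}/[\mathfrak{g},\mathfrak{g}]$ is free as a $\mathbb{K}$-module. Then there is an exact sequence of Leibniz algebras $$0\to\Gamma(\mathfrak{g}^{\mathrm{ab}})\overset{\psi}{\longrightarrow}\mathfrak{g}\star\mathfrak{g}\overset{(\pi,\overline{\tau})}{\longrightarrow}(\mathfrak{g}\curlywedge\mathfrak{g})\oplus(\mathfrak{g}^{\mathrm{ab}}\wedge\mathfrak{g}^{\mathrm{ab}})\to0 .$$ Here $\psi(\gamma(c+[\mathfrak{g},\mathfrak{g}]))=c*_1c-c*_2c$ for $c\in\mathfrak{g}$, $\pi$ is the canonical projection, and $\overline{\tau}$ is determined by $\overline{\tau}(x*_1y)=(x+[\mathfrak{g},\mathfrak{g}])\wedge(y+[\mathfrak{g},\mathfrak{g}])$ and $\overline{\tau}(x*_2y)=0$ for $x,y\in\mathfrak{g}$.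
   Context: $\mathbb{K}$ is a commutative ring with identity. A Leibniz algebra is a $\mathbb{K}$-module with a $\mathbb{K}$-bilinear bracket satisfying $[x,[y,z]]=[[x,y],z]-[[x,z],y]$. $[\mathfrak{g},\mathfrak{g}]$ is the submodule spanned by all brackets. The non-abelian tensor square $\mathfrak{g}\star\mathfrak{g}$ is the Leibniz algebra generated by two formally distinct families of symbols $x*_1y$ and $x*_2y$ ($x,y\in\mathfrak{g}$), both $\mathbb{K}$-bilinear, obtained by taking $\mathfrak{a}=\mathfrak{b}=\mathfrak{g}$ in the following general definition. For ideals $\mathfrak{a},\mathfrak{b}$ of $\mathfrak{g}$, $\mathfrak{a}\star\mathfrak{b}$ is generated by symbols $a*_1b$ and $b*_2a$ ($a\in\mathfrak{a}$, $b\in\mathfrak{b}$), bilinear, subject to, for all $a,a'\in\mathfrak{a}$, $b,b'\in\mathfrak{b}$: $a*_1[b,b']=[a,b]*_1b'-[a,b']*_1b$; $b*_2[a,a']=[b,a]*_2a'-[b,a']*_2a$; $[a,a']*_1b=[a,b]*_2a'-a*_1[b,a']$; $[b,b']*_2a=[b,a]*_1b'-b*_2[a,b']$; $a*_1[a',b]=-a*_1[b,a']$; $b*_2[b',a]=-b*_2[a,b']$; $[a,b]*_1[a',b']=[a*_1b,\,a'*_1b']=[a,b]*_2[a',b']$; $[b,a]*_1[b',a']=[b*_2a,\,b'*_2a']=[b,a]*_2[b',a']$; $[a,b]*_1[b',a']=[a*_1b,\,b'*_2a']=[a,b]*_2[b',a']$; $[b,a]*_1[a',b']=[b*_2a,\,a'*_1b']=[b,a]*_2[a',b']$.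 The exterior product $\mathfrak{a}\curlywedge\mathfrak{b}$ is the quotient of $\mathfrak{a}\star\mathfrak{b}$ by the (central) ideal generated as a submodule by all $c*_1c'-c*_2c'$, $c,c'\in\mathfrak{a}\cap\mathfrak{b}$. Universal quadratic functor: for a $\mathbb{K}$-module $A$, $\Gamma(A)$ is the $\mathbb{K}$-module generated by symbols $\gamma(a)$, $a\in A$, subject to $k^2\gamma(a)=\gamma(ka)$; $\gamma(a+b+c)+\gamma(a)+\gamma(b)+\gamma(c)=\gamma(a+b)+\gamma(a+c)+\gamma(b+c)$; $\gamma(ka+b)+k\gamma(a)+k\gamma(b)=k\gamma(a+b)+\gamma(ka)+\gamma(b)$ for $k\in\mathbb{K}$, $a,b,c\in A$. $\wedge$ denotes the exterior square of $\mathbb{K}$-modules. $\Gamma(\mathfrak{g}^{\mathrm{ab}})$ and $\mathfrak{g}^{\mathrm{ab}}\wedge\mathfrak{g}^{\mathrm{ab}}$ are regarded as abelian Leibniz algebras (zero bracket). The maps $\psi$ and $\overline{\tau}$ are well-defined homomorphisms of Leibniz algebras. *)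

(* Defs.v *)
From HB Require Import structures.
From mathcomp Require Import all_boot all_order all_algebra.
From mathcomp Require Import boolp.

Set Implicit Arguments.
Unset Strict Implicit.
Unset Printing Implicit Defensive.

Import GRing.Theory.
Local Open Scope ring_scope.
Local Open Scope quotient_scope.

HB.mixin Record Lmodule_isLeibniz (K : comPzRingType) L of GRing.Lmodule K L := {
  bracket : L -> L -> L;
  bracket_linearl : forall k x y z,
    bracket (k *: x + y) z = k *: bracket x z + bracket y z;
  bracket_linearr : forall k x y z,
    bracket x (k *: y + z) = k *: bracket x y + bracket x z;
  leibniz_identity : forall x y z,
    bracket x (bracket y z) =
      bracket (bracket x y) z - bracket (bracket x z) y
}.

#[short(type="leibnizType")]
HB.structure Definition Leibniz (K : comPzRingType) :=
  {L of GRing.Lmodule K L & Lmodule_isLeibniz K L}.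

Notation "{[ x , y ]}" := (bracket x y)
  (at level 0, x, y at level 200, format "{[ x ,  y ]}") : ring_scope.

Section BracketTheory.
Variables (K : comPzRingType) (L : leibnizType K).
Implicit Types x y z : L.

Lemma bracketDl x y z : {[x + y, z]} = {[x, z]} + {[y, z]}.
Proof. by have := bracket_linearl 1 x y z; rewrite !scale1r. Qed.
Lemma bracketDr x y z : {[x, y + z]} = {[x, y]} + {[x, z]}.
Proof. by have := bracket_linearr 1 x y z; rewrite !scale1r. Qed.
Lemma bracket0l y : {[0, y]} = 0 :> L.
Proof. by apply: (@addIr _ {[0, y]}); rewrite -bracketDl addr0 add0r. Qed.
Lemma bracket0r x : {[x, 0]} = 0 :> L.
Proof. by apply: (@addIr _ {[x, 0]}); rewrite -bracketDr addr0 add0r. Qed.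
Lemma bracketZl k x y : {[k *: x, y]} = k *: {[x, y]}.
Proof. by rewrite -[k *: x]addr0 bracket_linearl bracket0l addr0. Qed.
Lemma bracketZr k x y : {[x, k *: y]} = k *: {[x, y]}.
Proof. by rewrite -[k *: y]addr0 bracket_linearr bracket0r addr0. Qed.
Lemma bracketNl x y : {[- x, y]} = - {[x, y]}.
Proof. by rewrite -scaleN1r bracketZl scaleN1r. Qed.
Lemma bracketNr x y : {[x, - y]} = - {[x, y]}.
Proof. by rewrite -scaleN1r bracketZr scaleN1r. Qed.
Lemma bracketBl x y z : {[x - y, z]} = {[x, z]} - {[y, z]}.
Proof. by rewrite bracketDl bracketNl. Qed.
Lemma bracketBr x y z : {[x, y - z]} = {[x, y]} - {[x, z]}.
Proof. by rewrite bracketDr bracketNr. Qed.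
End BracketTheory.

HB.mixin Record isBracketMorphism (K : comPzRingType) (U V : leibnizType K)
    (f : U -> V) := {
  bracket_morph : forall x y, f {[x, y]} = {[f x, f y]}
}.

HB.structure Definition LeibnizMorphism (K : comPzRingType)
    (U V : leibnizType K) :=
  {f of isBracketMorphism K U V f & @GRing.Linear K U V *:%R f}.

Notation "{ 'leibniz' U -> V }" := (LeibnizMorphism.type U V)
  (at level 0, U at level 98, V at level 99,
   format "{ 'leibniz'  U  ->  V }") : type_scope.

Section DirectSum.
Variables (K : comPzRingType) (A B : leibnizType K).

Definition pair_bracket (u v : A * B) : A * B :=
  ({[u.1, v.1]}, {[u.2, v.2]}).

Fact pair_bracket_linearl k u v w :
  pair_bracket (k *: u + v) w = k *: pair_bracket u w + pair_bracket v w.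
Proof. by congr pair; rewrite /= bracket_linearl. Qed.
Fact pair_bracket_linearr k u v w :
  pair_bracket u (k *: v + w) = k *: pair_bracket u v + pair_bracket u w.
Proof. by congr pair; rewrite /= bracket_linearr. Qed.
Fact pair_leibniz u v w :
  pair_bracket u (pair_bracket v w) =
    pair_bracket (pair_bracket u v) w - pair_bracket (pair_bracket u w) v.
Proof. by congr pair; rewrite /= leibniz_identity. Qed.

HB.instance Definition _ := Lmodule_isLeibniz.Build K (A * B)%type
  pair_bracket_linearl pair_bracket_linearr pair_leibniz.

End DirectSum.

Section PairMorphism.
Variables (K : comPzRingType) (U A B : leibnizType K).
Variables (f : {leibniz U -> A}) (h : {leibniz U -> B}).

Definition pair_mor (u : U) : A * B := (f u, h u).

Fact pair_mor_linear : linear pair_mor.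
Proof. by move=> k x y; congr pair; rewrite /= linearP. Qed.
HB.instance Definition _ :=
  GRing.isLinear.Build K U (A * B)%type *:%R pair_mor pair_mor_linear.

Fact pair_mor_bracket x y : pair_mor {[x, y]} = {[pair_mor x, pair_mor y]}.
Proof. by congr pair; rewrite /= bracket_morph. Qed.
HB.instance Definition _ :=
  isBracketMorphism.Build K U (A * B)%type pair_mor pair_mor_bracket.

End PairMorphism.

Definition short_exact (K : comPzRingType) (A B C : leibnizType K)
    (f : {leibniz A -> B}) (h : {leibniz B -> C}) : Prop :=
  [/\ injective f,
      forall y, h y = 0 <-> exists x, f x = y
    & forall z, exists y, h y = z].

Section ModQuotient.
Variables (K : comPzRingType) (V : lmodType K) (S : submodClosed V).

(* [submodClosed] does not inherit from [zmodClosed], which [Quotient.quot]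
   requires. *)
Definition zmod_of_submod : {pred V} := fun v => v \in S.
Fact zmod_of_submod_closed : zmod_closed zmod_of_submod.
Proof.
split=> [|u v Su Sv]; first exact: rpred0.
by rewrite -scaleN1r; apply: rpredD => //; apply: rpredZ.
Qed.
HB.instance Definition _ :=
  GRing.isZmodClosed.Build V zmod_of_submod zmod_of_submod_closed.

Local Notation quot := (@Quotient.quot V zmod_of_submod).

Definition modquot : Type := quot.
HB.instance Definition _ := GRing.Zmodule.on modquot.

Definition modproj (v : V) : modquot := \pi_quot v.

Lemma modproj_eq u v : (modproj u = modproj v) <-> (u - v \in S).
Proof.
have -> : (u - v \in S) = (u == v %[mod quot]) by rewrite -Quotient.idealrBE.
by split=> [|/eqP//] H; apply/eqP.
Qed.

Lemma modproj_surj (q : modquot) : exists v, modproj v = q.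
Proof. by exists (repr (q : quot)); rewrite /modproj reprK. Qed.

Lemma modprojB : {morph modproj : u v / u - v}.
Proof. by move=> u v; rewrite /modproj raddfB. Qed.
HB.instance Definition _ :=
  GRing.isZmodMorphism.Build V modquot modproj modprojB.

Definition modquot_scale (k : K) (q : modquot) : modquot :=
  modproj (k *: repr (q : quot)).

Lemma modprojZ k v : modproj (k *: v) = modquot_scale k (modproj v).
Proof.
apply/modproj_eq; rewrite -scalerBr; apply: rpredZ.
by apply/modproj_eq; rewrite /modproj reprK.
Qed.

Fact modquot_scaleA a b q :
  modquot_scale a (modquot_scale b q) = modquot_scale (a * b) q.
Proof. by have [v <-] := modproj_surj q; rewrite -!modprojZ scalerA. Qed.
Fact modquot_scale1 : left_id 1 modquot_scale.
Proof. by move=> q; have [v <-] := modproj_surj q; rewrite -modprojZ scale1r. Qed.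
Fact modquot_scaleDr : right_distributive modquot_scale +%R.
Proof.
move=> k p q; have [u <-] := modproj_surj p; have [v <-] := modproj_surj q.
by rewrite -raddfD -!modprojZ -raddfD scalerDr.
Qed.
Fact modquot_scaleDl q : {morph modquot_scale^~ q : a b / a + b}.
Proof.
by move=> a b; have [v <-] := modproj_surj q; rewrite -!modprojZ -raddfD scalerDl.
Qed.
HB.instance Definition _ := GRing.Zmodule_isLmodule.Build K modquot
  modquot_scaleA modquot_scale1 modquot_scaleDr modquot_scaleDl.
HB.instance Definition _ :=
  GRing.isScalable.Build K V modquot *:%R modproj modprojZ.

End ModQuotient.

HB.mixin Record isBracketIdeal (K : comPzRingType) (L : leibnizType K)
    (S : {pred L}) := {
  bracket_ideal : forall x s, S s -> S {[x, s]} && S {[s, x]}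
}.

#[short(type="leibnizIdeal")]
HB.structure Definition LeibnizIdeal (K : comPzRingType) (L : leibnizType K) :=
  {S of @GRing.SubmodClosed K L S & isBracketIdeal K L S}.

Section LeibnizQuotient.
Variables (K : comPzRingType) (L : leibnizType K) (I : leibnizIdeal L).

Local Notation quot := (@Quotient.quot L (zmod_of_submod I)).

Definition leibquot : Type := modquot I.
HB.instance Definition _ := GRing.Lmodule.on leibquot.

Definition leibproj (x : L) : leibquot := modproj I x.
Fact leibproj_linear : linear leibproj.
Proof. exact: (linearP (modproj I)). Qed.
HB.instance Definition _ :=
  GRing.isLinear.Build K L leibquot *:%R leibproj leibproj_linear.

Lemma leibproj_eq x y : (leibproj x = leibproj y) <-> (x - y \in I).
Proof. exact: modproj_eq. Qed.

Lemma leibproj_surj (q : leibquot) : exists x, leibproj x = q.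
Proof. exact: modproj_surj. Qed.

Definition leibquot_bracket (p q : leibquot) : leibquot :=
  leibproj {[repr (p : quot), repr (q : quot)]}.

Lemma leibproj_bracket x y :
  leibproj {[x, y]} = leibquot_bracket (leibproj x) (leibproj y).
Proof.
apply/leibproj_eq; set x' := repr _; set y' := repr _.
have Hx : x - x' \in I by apply/leibproj_eq; rewrite /leibproj /modproj reprK.
have Hy : y - y' \in I by apply/leibproj_eq; rewrite /leibproj /modproj reprK.
have -> : {[x, y]} - {[x', y']} = {[x - x', y]} + {[x', y - y']}.
  by rewrite bracketBl bracketBr addrA subrK.
apply: rpredD; first by case/andP: (bracket_ideal y _ Hx).
by case/andP: (bracket_ideal x' _ Hy).
Qed.

Fact leibquot_linearl k p q r :
  leibquot_bracket (k *: p + q) r =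
    k *: leibquot_bracket p r + leibquot_bracket q r.
Proof.
have [x <-] := leibproj_surj p; have [y <-] := leibproj_surj q.
have [z <-] := leibproj_surj r.
by rewrite -linearP -!leibproj_bracket -linearP bracket_linearl.
Qed.
Fact leibquot_linearr k p q r :
  leibquot_bracket p (k *: q + r) =
    k *: leibquot_bracket p q + leibquot_bracket p r.
Proof.
have [x <-] := leibproj_surj p; have [y <-] := leibproj_surj q.
have [z <-] := leibproj_surj r.
by rewrite -linearP -!leibproj_bracket -linearP bracket_linearr.
Qed.
Fact leibquot_leibniz p q r :
  leibquot_bracket p (leibquot_bracket q r) =
    leibquot_bracket (leibquot_bracket p q) r
      - leibquot_bracket (leibquot_bracket p r) q.
Proof.
have [x <-] := leibproj_surj p; have [y <-] := leibproj_surj q.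
have [z <-] := leibproj_surj r.
by rewrite -!leibproj_bracket -linearB leibniz_identity.
Qed.
HB.instance Definition _ := Lmodule_isLeibniz.Build K leibquot
  leibquot_linearl leibquot_linearr leibquot_leibniz.
HB.instance Definition _ :=
  isBracketMorphism.Build K L leibquot leibproj leibproj_bracket.

End LeibnizQuotient.

Section Span.
Variables (K : comPzRingType) (V : lmodType K) (G : V -> Prop).

Inductive in_span : V -> Prop :=
| span_zero : in_span 0
| span_step k u v : G u -> in_span v -> in_span (k *: u + v).

Definition span : {pred V} := fun v => `[< in_span v >].

Fact span_submod : submod_closed span.
Proof.
split=> [|k u v /asboolP Hu /asboolP Hv]; apply/asboolP; first exact: span_zero.
elim: Hu => [|l w u' Gw _ IH]; first by rewrite scaler0 add0r.
by rewrite scalerDr scalerA -addrA; apply: span_step.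
Qed.
HB.instance Definition _ := GRing.isSubmodClosed.Build K V span span_submod.

End Span.

Section GeneratedIdeal.
Variables (K : comPzRingType) (L : leibnizType K) (G : L -> Prop).

Inductive in_ideal : L -> Prop :=
| ideal_gen u : G u -> in_ideal u
| ideal_zero : in_ideal 0
| ideal_linear k u v : in_ideal u -> in_ideal v -> in_ideal (k *: u + v)
| ideal_bracketl x u : in_ideal u -> in_ideal {[x, u]}
| ideal_bracketr x u : in_ideal u -> in_ideal {[u, x]}.

Definition ideal : {pred L} := fun x => `[< in_ideal x >].

Fact ideal_submod : submod_closed ideal.
Proof.
split=> [|k u v /asboolP Hu /asboolP Hv]; apply/asboolP; first exact: ideal_zero.
exact: ideal_linear.
Qed.
HB.instance Definition _ := GRing.isSubmodClosed.Build K L ideal ideal_submod.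

Fact ideal_bracket x u : ideal u -> ideal {[x, u]} && ideal {[u, x]}.
Proof.
move=> /asboolP Hu; apply/andP; split; apply/asboolP.
  exact: ideal_bracketl.
exact: ideal_bracketr.
Qed.
HB.instance Definition _ := isBracketIdeal.Build K L ideal ideal_bracket.

End GeneratedIdeal.

(* Free modules and free Leibniz algebras are built as sets of formal terms
   modulo the least congruence containing the axioms of the structure. *)

Section FreeModule.
Variables (K : comPzRingType) (X : Type).

Inductive mterm : Type :=
| MVar of X
| MZero
| MOpp of mterm
| MAdd of mterm & mterm
| MScale of K & mterm.

HB.instance Definition _ := gen_eqMixin mterm.
HB.instance Definition _ := gen_choiceMixin mterm.

Inductive mcong : mterm -> mterm -> Prop :=
| mcong_refl s : mcong s s
| mcong_sym s t : mcong s t -> mcong t s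
| mcong_trans s t u : mcong s t -> mcong t u -> mcong s u
| mcong_opp s s' : mcong s s' -> mcong (MOpp s) (MOpp s')
| mcong_add s s' t t' : mcong s s' -> mcong t t' ->
    mcong (MAdd s t) (MAdd s' t')
| mcong_scale k s s' : mcong s s' -> mcong (MScale k s) (MScale k s')
| mcong_addA s t u : mcong (MAdd s (MAdd t u)) (MAdd (MAdd s t) u)
| mcong_addC s t : mcong (MAdd s t) (MAdd t s)
| mcong_add0 s : mcong (MAdd MZero s) s
| mcong_addN s : mcong (MAdd (MOpp s) s) MZero
| mcong_scaleA a b s : mcong (MScale a (MScale b s)) (MScale (a * b) s)
| mcong_scale1 s : mcong (MScale 1 s) s
| mcong_scaleDr k s t :
    mcong (MScale k (MAdd s t)) (MAdd (MScale k s) (MScale k t))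
| mcong_scaleDl a b s :
    mcong (MScale (a + b) s) (MAdd (MScale a s) (MScale b s)).

Definition mcongb (s t : mterm) : bool := `[< mcong s t >].

Fact mcongb_equiv : equiv_class_of mcongb.
Proof.
split=> [s|s t|t s u].
- exact/asboolP/mcong_refl.
- by apply/asboolP/asboolP; apply: mcong_sym.
- by move=> /asboolP H1 /asboolP H2; apply/asboolP/(mcong_trans H1 H2).
Qed.
Canonical mcongb_equiv_rel := EquivRelPack mcongb_equiv.
Canonical mcongb_encModRel := defaultEncModRel mcongb.

Definition freemod : Type := {eq_quot mcongb}.
HB.instance Definition _ := Choice.on freemod.

Definition mclass (s : mterm) : freemod := \pi_({eq_quot mcongb}) s.

Lemma mclass_eq s t : (mclass s = mclass t) <-> mcong s t.
Proof.
rewrite /mclass; split=> [H|H]; last by apply/eqP; rewrite piE; apply/asboolP.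
by apply/asboolP; have /eqP := H; rewrite piE.
Qed.

Lemma mclass_surj (q : freemod) : exists s, mclass s = q.
Proof. by exists (repr (q : {eq_quot mcongb})); rewrite /mclass reprK. Qed.

Let rep (q : freemod) : mterm := repr (q : {eq_quot mcongb}).
Let repP s : mcong s (rep (mclass s)).
Proof. by apply/mclass_eq; rewrite /rep /mclass reprK. Qed.

Definition fm_opp (p : freemod) := mclass (MOpp (rep p)).
Definition fm_add (p q : freemod) := mclass (MAdd (rep p) (rep q)).
Definition fm_scale (k : K) (p : freemod) := mclass (MScale k (rep p)).

Lemma mclass_opp s : mclass (MOpp s) = fm_opp (mclass s).
Proof. exact/mclass_eq/mcong_opp/repP. Qed.
Lemma mclass_add s t : mclass (MAdd s t) = fm_add (mclass s) (mclass t).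
Proof. by apply/mclass_eq/mcong_add; apply: repP. Qed.
Lemma mclass_scale k s : mclass (MScale k s) = fm_scale k (mclass s).
Proof. exact/mclass_eq/mcong_scale/repP. Qed.

Fact fm_addA : associative fm_add.
Proof.
move=> p q r; have [s <-] := mclass_surj p; have [t <-] := mclass_surj q.
have [u <-] := mclass_surj r.
by rewrite -!mclass_add; apply/mclass_eq/mcong_addA.
Qed.
Fact fm_addC : commutative fm_add.
Proof.
move=> p q; have [s <-] := mclass_surj p; have [t <-] := mclass_surj q.
by rewrite -!mclass_add; apply/mclass_eq/mcong_addC.
Qed.
Fact fm_add0 : left_id (mclass MZero) fm_add.
Proof.
move=> p; have [s <-] := mclass_surj p.
by rewrite -mclass_add; apply/mclass_eq/mcong_add0.
Qed.
Fact fm_addN : left_inverse (mclass MZero) fm_opp fm_add.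
Proof.
move=> p; have [s <-] := mclass_surj p.
by rewrite -mclass_opp -mclass_add; apply/mclass_eq/mcong_addN.
Qed.
HB.instance Definition _ :=
  GRing.isZmodule.Build freemod fm_addA fm_addC fm_add0 fm_addN.

Fact fm_scaleA a b p : fm_scale a (fm_scale b p) = fm_scale (a * b) p.
Proof.
have [s <-] := mclass_surj p.
by rewrite -!mclass_scale; apply/mclass_eq/mcong_scaleA.
Qed.
Fact fm_scale1 : left_id 1 fm_scale.
Proof.
move=> p; have [s <-] := mclass_surj p.
by rewrite -!mclass_scale; apply/mclass_eq/mcong_scale1.
Qed.
Fact fm_scaleDr : right_distributive fm_scale +%R.
Proof.
move=> k p q; have [s <-] := mclass_surj p; have [t <-] := mclass_surj q.
rewrite -[_ + _]mclass_add -!mclass_scale -[_ + _]mclass_add.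
exact/mclass_eq/mcong_scaleDr.
Qed.
Fact fm_scaleDl p : {morph fm_scale^~ p : a b / a + b}.
Proof.
move=> a b; have [s <-] := mclass_surj p.
rewrite -!mclass_scale; apply: etrans (mclass_add _ _).
exact/mclass_eq/mcong_scaleDl.
Qed.
HB.instance Definition _ := GRing.Zmodule_isLmodule.Build K freemod
  fm_scaleA fm_scale1 fm_scaleDr fm_scaleDl.

Definition mgen (x : X) : freemod := mclass (MVar x).

Lemma freemod_ind (P : freemod -> Prop) :
  (forall x, P (mgen x)) -> P 0 ->
  (forall k u v, P u -> P v -> P (k *: u + v)) -> forall u, P u.
Proof.
move=> Pg P0 PL u; have [s <-] := mclass_surj u; elim: s => [x||s IH|s IHs t IHt|k s IH].
- exact: Pg.
- exact: P0.
- rewrite mclass_opp; have := PL (-1) _ _ IH P0.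
  by rewrite addr0 scaleN1r.
- by rewrite mclass_add; have := PL 1 _ _ IHs IHt; rewrite scale1r.
- by rewrite mclass_scale; have := PL k _ _ IH P0; rewrite addr0.
Qed.

End FreeModule.

Section FreeLeibniz.
Variables (K : comPzRingType) (X : Type).

Inductive lterm : Type :=
| LVar of X
| LZero
| LOpp of lterm
| LAdd of lterm & lterm
| LScale of K & lterm
| LBracket of lterm & lterm.

HB.instance Definition _ := gen_eqMixin lterm.
HB.instance Definition _ := gen_choiceMixin lterm.

Inductive lcong : lterm -> lterm -> Prop :=
| lcong_refl s : lcong s s
| lcong_sym s t : lcong s t -> lcong t s
| lcong_trans s t u : lcong s t -> lcong t u -> lcong s u
| lcong_opp s s' : lcong s s' -> lcong (LOpp s) (LOpp s')
| lcong_add s s' t t' : lcong s s' -> lcong t t' ->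
    lcong (LAdd s t) (LAdd s' t')
| lcong_scale k s s' : lcong s s' -> lcong (LScale k s) (LScale k s')
| lcong_bracket s s' t t' : lcong s s' -> lcong t t' ->
    lcong (LBracket s t) (LBracket s' t')
| lcong_addA s t u : lcong (LAdd s (LAdd t u)) (LAdd (LAdd s t) u)
| lcong_addC s t : lcong (LAdd s t) (LAdd t s)
| lcong_add0 s : lcong (LAdd LZero s) s
| lcong_addN s : lcong (LAdd (LOpp s) s) LZero
| lcong_scaleA a b s : lcong (LScale a (LScale b s)) (LScale (a * b) s)
| lcong_scale1 s : lcong (LScale 1 s) s
| lcong_scaleDr k s t :
    lcong (LScale k (LAdd s t)) (LAdd (LScale k s) (LScale k t))
| lcong_scaleDl a b s :
    lcong (LScale (a + b) s) (LAdd (LScale a s) (LScale b s))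
| lcong_linearl k s t u :
    lcong (LBracket (LAdd (LScale k s) t) u)
          (LAdd (LScale k (LBracket s u)) (LBracket t u))
| lcong_linearr k s t u :
    lcong (LBracket s (LAdd (LScale k t) u))
          (LAdd (LScale k (LBracket s t)) (LBracket s u))
| lcong_leibniz s t u :
    lcong (LBracket s (LBracket t u))
          (LAdd (LBracket (LBracket s t) u)
                (LOpp (LBracket (LBracket s u) t))).

Definition lcongb (s t : lterm) : bool := `[< lcong s t >].

Fact lcongb_equiv : equiv_class_of lcongb.
Proof.
split=> [s|s t|t s u].
- exact/asboolP/lcong_refl.
- by apply/asboolP/asboolP; apply: lcong_sym.
- by move=> /asboolP H1 /asboolP H2; apply/asboolP/(lcong_trans H1 H2).
Qed.
Canonical lcongb_equiv_rel := EquivRelPack lcongb_equiv.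
Canonical lcongb_encModRel := defaultEncModRel lcongb.

Definition freeleib : Type := {eq_quot lcongb}.
HB.instance Definition _ := Choice.on freeleib.

Definition lclass (s : lterm) : freeleib := \pi_({eq_quot lcongb}) s.

Lemma lclass_eq s t : (lclass s = lclass t) <-> lcong s t.
Proof.
rewrite /lclass; split=> [H|H]; last by apply/eqP; rewrite piE; apply/asboolP.
by apply/asboolP; have /eqP := H; rewrite piE.
Qed.

Lemma lclass_surj (q : freeleib) : exists s, lclass s = q.
Proof. by exists (repr (q : {eq_quot lcongb})); rewrite /lclass reprK. Qed.

Let rep (q : freeleib) : lterm := repr (q : {eq_quot lcongb}).
Let repP s : lcong s (rep (lclass s)).
Proof. by apply/lclass_eq; rewrite /rep /lclass reprK. Qed.

Definition fl_opp (p : freeleib) := lclass (LOpp (rep p)).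
Definition fl_add (p q : freeleib) := lclass (LAdd (rep p) (rep q)).
Definition fl_scale (k : K) (p : freeleib) := lclass (LScale k (rep p)).
Definition fl_bracket (p q : freeleib) := lclass (LBracket (rep p) (rep q)).

Lemma lclass_opp s : lclass (LOpp s) = fl_opp (lclass s).
Proof. exact/lclass_eq/lcong_opp/repP. Qed.
Lemma lclass_add s t : lclass (LAdd s t) = fl_add (lclass s) (lclass t).
Proof. by apply/lclass_eq/lcong_add; apply: repP. Qed.
Lemma lclass_scale k s : lclass (LScale k s) = fl_scale k (lclass s).
Proof. exact/lclass_eq/lcong_scale/repP. Qed.
Lemma lclass_bracket s t :
  lclass (LBracket s t) = fl_bracket (lclass s) (lclass t).
Proof. by apply/lclass_eq/lcong_bracket; apply: repP. Qed.

Fact fl_addA : associative fl_add.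
Proof.
move=> p q r; have [s <-] := lclass_surj p; have [t <-] := lclass_surj q.
have [u <-] := lclass_surj r.
by rewrite -!lclass_add; apply/lclass_eq/lcong_addA.
Qed.
Fact fl_addC : commutative fl_add.
Proof.
move=> p q; have [s <-] := lclass_surj p; have [t <-] := lclass_surj q.
by rewrite -!lclass_add; apply/lclass_eq/lcong_addC.
Qed.
Fact fl_add0 : left_id (lclass LZero) fl_add.
Proof.
move=> p; have [s <-] := lclass_surj p.
by rewrite -lclass_add; apply/lclass_eq/lcong_add0.
Qed.
Fact fl_addN : left_inverse (lclass LZero) fl_opp fl_add.
Proof.
move=> p; have [s <-] := lclass_surj p.
by rewrite -lclass_opp -lclass_add; apply/lclass_eq/lcong_addN.
Qed.
HB.instance Definition _ :=
  GRing.isZmodule.Build freeleib fl_addA fl_addC fl_add0 fl_addN.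

Fact fl_scaleA a b p : fl_scale a (fl_scale b p) = fl_scale (a * b) p.
Proof.
have [s <-] := lclass_surj p.
by rewrite -!lclass_scale; apply/lclass_eq/lcong_scaleA.
Qed.
Fact fl_scale1 : left_id 1 fl_scale.
Proof.
move=> p; have [s <-] := lclass_surj p.
by rewrite -!lclass_scale; apply/lclass_eq/lcong_scale1.
Qed.
Fact fl_scaleDr : right_distributive fl_scale +%R.
Proof.
move=> k p q; have [s <-] := lclass_surj p; have [t <-] := lclass_surj q.
rewrite -[_ + _]lclass_add -!lclass_scale -[_ + _]lclass_add.
exact/lclass_eq/lcong_scaleDr.
Qed.
Fact fl_scaleDl p : {morph fl_scale^~ p : a b / a + b}.
Proof.
move=> a b; have [s <-] := lclass_surj p.
rewrite -!lclass_scale; apply: etrans (lclass_add _ _).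
exact/lclass_eq/lcong_scaleDl.
Qed.
HB.instance Definition _ := GRing.Zmodule_isLmodule.Build K freeleib
  fl_scaleA fl_scale1 fl_scaleDr fl_scaleDl.

Fact fl_linearl k (p q r : freeleib) :
  fl_bracket (k *: p + q) r = k *: fl_bracket p r + fl_bracket q r.
Proof.
have [s <-] := lclass_surj p; have [t <-] := lclass_surj q.
have [u <-] := lclass_surj r.
rewrite -[k *: lclass s]lclass_scale -[_ + _]lclass_add -!lclass_bracket.
rewrite -[k *: lclass _]lclass_scale -[_ + _]lclass_add.
exact/lclass_eq/lcong_linearl.
Qed.
Fact fl_linearr k (p q r : freeleib) :
  fl_bracket p (k *: q + r) = k *: fl_bracket p q + fl_bracket p r.
Proof.
have [s <-] := lclass_surj p; have [t <-] := lclass_surj q.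
have [u <-] := lclass_surj r.
rewrite -[k *: lclass t]lclass_scale -[_ + _]lclass_add -!lclass_bracket.
rewrite -[k *: lclass _]lclass_scale -[_ + _]lclass_add.
exact/lclass_eq/lcong_linearr.
Qed.
Fact fl_leibniz (p q r : freeleib) :
  fl_bracket p (fl_bracket q r) =
    fl_bracket (fl_bracket p q) r - fl_bracket (fl_bracket p r) q.
Proof.
have [s <-] := lclass_surj p; have [t <-] := lclass_surj q.
have [u <-] := lclass_surj r.
rewrite -!lclass_bracket -[- lclass _]lclass_opp -[_ + _]lclass_add.
exact/lclass_eq/lcong_leibniz.
Qed.
HB.instance Definition _ := Lmodule_isLeibniz.Build K freeleib
  fl_linearl fl_linearr fl_leibniz.

Definition lgen (x : X) : freeleib := lclass (LVar x).

Lemma freeleib_ind (P : freeleib -> Prop) :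
  (forall x, P (lgen x)) -> P 0 ->
  (forall k u v, P u -> P v -> P (k *: u + v)) ->
  (forall u v, P u -> P v -> P {[u, v]}) -> forall u, P u.
Proof.
move=> Pg P0 PL PB u; have [s <-] := lclass_surj u.
elim: s => [x||s IH|s IHs t IHt|k s IH|s IHs t IHt].
- exact: Pg.
- exact: P0.
- rewrite lclass_opp; have := PL (-1) _ _ IH P0.
  by rewrite addr0 scaleN1r.
- by rewrite lclass_add; have := PL 1 _ _ IHs IHt; rewrite scale1r.
- by rewrite lclass_scale; have := PL k _ _ IH P0; rewrite addr0.
- by rewrite lclass_bracket; apply: PB.
Qed.

End FreeLeibniz.

Definition free_module (K : comPzRingType) (V : lmodType K) : Prop :=
  exists (I : choiceType) (b : I -> V),
    (forall v, exists (s : seq I) (c : I -> K), v = \sum_(i <- s) c i *: b i)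
    /\ (forall (s : seq I) (c : I -> K), uniq s ->
          \sum_(i <- s) c i *: b i = 0 -> forall i, i \in s -> c i = 0).

Section Abelianization.
Variables (K : comPzRingType) (g : leibnizType K).

Definition is_bracket (z : g) : Prop := exists x y : g, z = {[x, y]}.
Definition abelianization : lmodType K := modquot (span is_bracket).
Definition abclass (x : g) : abelianization := modproj (span is_bracket) x.

End Abelianization.

Section Gamma.
Variables (K : comPzRingType) (A : lmodType K).

Local Notation gam := (@mgen K A).

Variant gamma_rel : freemod K A -> freemod K A -> Prop :=
| gamma_sq k a : gamma_rel (k ^+ 2 *: gam a) (gam (k *: a))
| gamma_add3 a b c :
    gamma_rel (gam (a + b + c) + gam a + gam b + gam c)
              (gam (a + b) + gam (a + c) + gam (b + c))
| gamma_lin k a b :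
    gamma_rel (gam (k *: a + b) + k *: gam a + k *: gam b)
              (k *: gam (a + b) + gam (k *: a) + gam b).

Definition gamma_relator (z : freemod K A) : Prop :=
  exists u v, gamma_rel u v /\ z = u - v.

Definition Gamma : Type := modquot (span gamma_relator).
HB.instance Definition _ := GRing.Lmodule.on Gamma.

Definition gamma (a : A) : Gamma := modproj (span gamma_relator) (gam a).

End Gamma.

Section ExteriorSquare.
Variables (K : comPzRingType) (A : lmodType K).

Local Notation wdg a b := (@mgen K (A * A) (a, b)).

Variant wedge_rel : freemod K (A * A) -> freemod K (A * A) -> Prop :=
| wedge_linearl k a a' b :
    wedge_rel (wdg (k *: a + a') b) (k *: wdg a b + wdg a' b)
| wedge_linearr k a b b' :
    wedge_rel (wdg a (k *: b + b')) (k *: wdg a b + wdg a b')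
| wedge_alt a : wedge_rel (wdg a a) 0.

Definition wedge_relator (z : freemod K (A * A)) : Prop :=
  exists u v, wedge_rel u v /\ z = u - v.

Definition ExtSquare : Type := modquot (span wedge_relator).
HB.instance Definition _ := GRing.Lmodule.on ExtSquare.

Definition wedge (a b : A) : ExtSquare :=
  modproj (span wedge_relator) (wdg a b).

End ExteriorSquare.

Section ZeroBracket.
Variables (K : comPzRingType) (V : lmodType K).

Definition zero_bracket (x y : V) : V := 0.
Fact zero_bracket_linearl k x y z :
  zero_bracket (k *: x + y) z = k *: zero_bracket x z + zero_bracket y z.
Proof. by rewrite /zero_bracket scaler0 addr0. Qed.
Fact zero_bracket_linearr k x y z :
  zero_bracket x (k *: y + z) = k *: zero_bracket x y + zero_bracket x z.
Proof. by rewrite /zero_bracket scaler0 addr0. Qed.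
Fact zero_bracket_leibniz x y z :
  zero_bracket x (zero_bracket y z) =
    zero_bracket (zero_bracket x y) z - zero_bracket (zero_bracket x z) y.
Proof. by rewrite /zero_bracket subr0. Qed.
End ZeroBracket.

HB.instance Definition _ (K : comPzRingType) (A : lmodType K) :=
  Lmodule_isLeibniz.Build K (Gamma A) (@zero_bracket_linearl K (Gamma A))
    (@zero_bracket_linearr K (Gamma A)) (@zero_bracket_leibniz K (Gamma A)).

HB.instance Definition _ (K : comPzRingType) (A : lmodType K) :=
  Lmodule_isLeibniz.Build K (ExtSquare A)
    (@zero_bracket_linearl K (ExtSquare A))
    (@zero_bracket_linearr K (ExtSquare A))
    (@zero_bracket_leibniz K (ExtSquare A)).

Section TensorSquare.
Variables (K : comPzRingType) (g : leibnizType K).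

Variant star_symbol : Type := Star1 of g & g | Star2 of g & g.

Local Notation F := (freeleib K star_symbol).
Local Notation "x *1 y" := (lgen K (Star1 x y)) (at level 40).
Local Notation "x *2 y" := (lgen K (Star2 x y)) (at level 40).

(* The letters [a], [b] record the ideals of the general product of two ideals;
   here both ideals are [g]. *)
Variant star_rel : F -> F -> Prop :=
| star1_linearl k a a' b :
    star_rel ((k *: a + a') *1 b) (k *: (a *1 b) + a' *1 b)
| star1_linearr k a b b' :
    star_rel (a *1 (k *: b + b')) (k *: (a *1 b) + a *1 b')
| star2_linearl k b b' a :
    star_rel ((k *: b + b') *2 a) (k *: (b *2 a) + b' *2 a)
| star2_linearr k b a a' :
    star_rel (b *2 (k *: a + a')) (k *: (b *2 a) + b *2 a')
| star1_bracketr a b b' :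
    star_rel (a *1 {[b, b']}) ({[a, b]} *1 b' - {[a, b']} *1 b)
| star2_bracketr b a a' :
    star_rel (b *2 {[a, a']}) ({[b, a]} *2 a' - {[b, a']} *2 a)
| star1_bracketl a a' b :
    star_rel ({[a, a']} *1 b) ({[a, b]} *2 a' - a *1 {[b, a']})
| star2_bracketl b b' a :
    star_rel ({[b, b']} *2 a) ({[b, a]} *1 b' - b *2 {[a, b']})
| star1_anti a a' b :
    star_rel (a *1 {[a', b]}) (- (a *1 {[b, a']}))
| star2_anti b b' a :
    star_rel (b *2 {[b', a]}) (- (b *2 {[a, b']}))
| star_11l a b a' b' :
    star_rel ({[a, b]} *1 {[a', b']}) {[a *1 b, a' *1 b']}
| star_11r a b a' b' :
    star_rel {[a *1 b, a' *1 b']} ({[a, b]} *2 {[a', b']})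
| star_22l b a b' a' :
    star_rel ({[b, a]} *1 {[b', a']}) {[b *2 a, b' *2 a']}
| star_22r b a b' a' :
    star_rel {[b *2 a, b' *2 a']} ({[b, a]} *2 {[b', a']})
| star_12l a b b' a' :
    star_rel ({[a, b]} *1 {[b', a']}) {[a *1 b, b' *2 a']}
| star_12r a b b' a' :
    star_rel {[a *1 b, b' *2 a']} ({[a, b]} *2 {[b', a']})
| star_21l b a a' b' :
    star_rel ({[b, a]} *1 {[a', b']}) {[b *2 a, a' *1 b']}
| star_21r b a a' b' :
    star_rel {[b *2 a, a' *1 b']} ({[b, a]} *2 {[a', b']}).

Definition star_relator (z : F) : Prop :=
  exists u v, star_rel u v /\ z = u - v.

Definition tensor_square : leibnizType K := leibquot (ideal star_relator).

Definition star1 (x y : g) : tensor_square :=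
  leibproj (ideal star_relator) (x *1 y).
Definition star2 (x y : g) : tensor_square :=
  leibproj (ideal star_relator) (x *2 y).

Lemma tensor_square_ind (P : tensor_square -> Prop) :
  (forall x y, P (star1 x y)) -> (forall x y, P (star2 x y)) -> P 0 ->
  (forall k u v, P u -> P v -> P (k *: u + v)) ->
  (forall u v, P u -> P v -> P {[u, v]}) -> forall u, P u.
Proof.
move=> P1 P2 P0 PL PB q; have [u <-] := leibproj_surj q.
elim/freeleib_ind: u => [[x y|x y]||k u v Pu Pv|u v Pu Pv].
- exact: P1.
- exact: P2.
- by rewrite linear0.
- by rewrite linearP; apply: PL.
- by rewrite bracket_morph; apply: PB.
Qed.

Lemma star_relE u v : star_rel u v ->
  leibproj (ideal star_relator) u = leibproj (ideal star_relator) v.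
Proof.
by move=> H; apply/leibproj_eq/asboolP/ideal_gen; exists u, v.
Qed.

(* The generators are central, so the submodule they span is already an ideal:
   see [diagonal_gen_central] below. *)
Definition diagonal_gen (z : tensor_square) : Prop :=
  exists c c' : g, z = star1 c c' - star2 c c'.

Lemma bracket_star11 a b a' b' :
  {[star1 a b, star1 a' b']} = star1 {[a, b]} {[a', b']}.
Proof. by rewrite -bracket_morph; apply/esym/star_relE/star_11l. Qed.
Lemma bracket_star22 a b a' b' :
  {[star2 a b, star2 a' b']} = star1 {[a, b]} {[a', b']}.
Proof. by rewrite -bracket_morph; apply/esym/star_relE/star_22l. Qed.
Lemma bracket_star12 a b a' b' :
  {[star1 a b, star2 a' b']} = star1 {[a, b]} {[a', b']}.
Proof. by rewrite -bracket_morph; apply/esym/star_relE/star_12l. Qed.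
Lemma bracket_star21 a b a' b' :
  {[star2 a b, star1 a' b']} = star1 {[a, b]} {[a', b']}.
Proof. by rewrite -bracket_morph; apply/esym/star_relE/star_21l. Qed.

Lemma diagonal_gen_central z x :
  diagonal_gen z -> {[z, x]} = 0 /\ {[x, z]} = 0.
Proof.
move=> [c [c' ->]]; set d := _ - _.
elim/tensor_square_ind: x => [x y|x y||k u v [u1 u2] [v1 v2]|u v [u1 u2] [v1 v2]].
- by rewrite bracketBl bracketBr !bracket_star11 bracket_star21 bracket_star12 !subrr.
- by rewrite bracketBl bracketBr !bracket_star22 bracket_star21 bracket_star12 !subrr.
- by rewrite bracket0l bracket0r.
- by rewrite bracket_linearl bracket_linearr u1 u2 v1 v2 scaler0 addr0.
- split; first by rewrite leibniz_identity u1 v1 !bracket0l subrr.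
  have := leibniz_identity u v d.
  by rewrite v2 u2 bracket0r bracket0l subr0 => <-.
Qed.

Fact diagonal_ideal x z : span diagonal_gen z ->
  span diagonal_gen {[x, z]} && span diagonal_gen {[z, x]}.
Proof.
move=> /asboolP Hz.
suff [-> ->] : {[x, z]} = 0 /\ {[z, x]} = 0 by rewrite andbb; apply/asboolP/span_zero.
elim: Hz => [|k u v Gu _ [H1 H2]]; first by rewrite bracket0l bracket0r.
have [u1 u2] := diagonal_gen_central x Gu.
by rewrite bracket_linearl bracket_linearr u1 u2 H1 H2 scaler0 addr0.
Qed.
HB.instance Definition _ :=
  isBracketIdeal.Build K tensor_square (span diagonal_gen) diagonal_ideal.

Definition exterior_square : leibnizType K := leibquot (span diagonal_gen).

Definition exterior_proj : {leibniz tensor_square -> exterior_square} :=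
  leibproj (span diagonal_gen).

End TensorSquare.

(* Main.v *)
Require Import Defs.
From HB Require Import structures.
From mathcomp Require Import all_boot all_order all_algebra.
From mathcomp Require Import boolp.

(** Put A = g^ab and d(x, y) = x *1 y - x *2 y.  The relations of g * g force d to
    vanish when either argument is a bracket, so d descends to a bilinear map on
    A x A whose values span ker pi.  A bilinear map beta on A x A conversely
    induces a homomorphism x *1 y |-> beta(x, y), x *2 y |-> 0 from g * g to an
    abelian Leibniz algebra, since every defining relation only involves symbols
    with a bracket entry.  Taking beta to be the wedge gives tau, and on ker pi
    the map tau becomes the canonical map from A (x) A to the exterior square,
    whose kernel is spanned by the a (x) a; this yields exactness at g * g and
    surjectivity.  For injectivity of psi, a finite part of a basis of A supplies
    a bilinear map rho with values in Gamma(A) such that rho(a, a) = gamma(a) on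
    its span; the homomorphism induced by rho is a left inverse of psi on any
    prescribed element. *)

Set Implicit Arguments.
Unset Strict Implicit.
Unset Printing Implicit Defensive.

Import GRing.Theory.
Local Open Scope ring_scope.

(* MathComp's [vector.span] shadows the one of [Defs]. *)
Local Notation span := Defs.span.

(** * Universal properties of free objects, quotients and spans *)

Section UniversalProperties.
Variable K : comPzRingType.

(** Bundles functions that arise inside a proof, such as composites with a chosen section. *)
Lemma linear_exists (V W : lmodType K) (f : V -> W) :
  linear f -> exists h : {linear V -> W}, h =1 f.
Proof.
move=> lf; pose fM := GRing.isLinear.Build K V W *:%R f lf.
pose F : {linear V -> W} := HB.pack f fM.
by exists F.
Qed.

Lemma leibniz_exists (V W : leibnizType K) (f : V -> W) :
  linear f -> (forall x y, f {[x, y]} = {[f x, f y]}) ->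
  exists h : {leibniz V -> W}, h =1 f.
Proof.
move=> lf bf; pose fL := GRing.isLinear.Build K V W *:%R f lf.
pose fB := isBracketMorphism.Build K V W f bf.
pose F : {leibniz V -> W} := HB.pack f fL fB.
by exists F.
Qed.

(** Terms are evaluated recursively in [W]; the evaluation respects [mcong] because [W] satisfies
    each module axiom, so it may be computed on a chosen representative. *)
Lemma freemod_lift (X : Type) (W : lmodType K) (f : X -> W) :
  exists h : {linear freemod K X -> W}, forall x, h (mgen K x) = f x.
Proof.
pose fix ev (t : mterm K X) : W := match t with
  | MVar x => f x | MZero => 0 | MOpp s => - ev s
  | MAdd s t => ev s + ev t | MScale k s => k *: ev s end.
have evP s t : mcong s t -> ev s = ev t.
  elim=> {s t} //=.
  - by move=> s t u _ -> _ ->.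
  - by move=> s s' _ ->.
  - by move=> s s' t t' _ -> _ ->.
  - by move=> k s s' _ ->.
  - by move=> *; rewrite addrA.
  - by move=> *; rewrite addrC.
  - by move=> *; rewrite add0r.
  - by move=> *; rewrite addNr.
  - by move=> *; rewrite scalerA.
  - by move=> *; rewrite scale1r.
  - by move=> *; rewrite scalerDr.
  - by move=> *; rewrite scalerDl.
have [r rK] := choice (@mclass_surj K X).
have evE s : ev (r (mclass s)) = ev s by apply/evP/mclass_eq/rK.
have [h hE] : exists h : {linear freemod K X -> W}, h =1 ev \o r.
  apply: linear_exists => k u v /=.
  rewrite -{1}(rK u) -{1}(rK v).
  by rewrite -[k *: _]mclass_scale -[_ + _]mclass_add evE.
by exists h => x; rewrite hE /= evE.
Qed.

Lemma freeleib_lift (X : Type) (W : leibnizType K) (f : X -> W) :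
  exists h : {leibniz freeleib K X -> W}, forall x, h (lgen K x) = f x.
Proof.
pose fix ev (t : lterm K X) : W := match t with
  | LVar x => f x | LZero => 0 | LOpp s => - ev s
  | LAdd s t => ev s + ev t | LScale k s => k *: ev s
  | LBracket s t => {[ev s, ev t]} end.
have evP s t : lcong s t -> ev s = ev t.
  elim=> {s t} //=.
  - by move=> s t u _ -> _ ->.
  - by move=> s s' _ ->.
  - by move=> s s' t t' _ -> _ ->.
  - by move=> k s s' _ ->.
  - by move=> s s' t t' _ -> _ ->.
  - by move=> *; rewrite addrA.
  - by move=> *; rewrite addrC.
  - by move=> *; rewrite add0r.
  - by move=> *; rewrite addNr.
  - by move=> *; rewrite scalerA.
  - by move=> *; rewrite scale1r.
  - by move=> *; rewrite scalerDr.
  - by move=> *; rewrite scalerDl.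
  - by move=> *; rewrite bracket_linearl.
  - by move=> *; rewrite bracket_linearr.
  - by move=> *; rewrite leibniz_identity.
have [r rK] := choice (@lclass_surj K X).
have evE s : ev (r (lclass s)) = ev s by apply/evP/lclass_eq/rK.
have [h hE] : exists h : {leibniz freeleib K X -> W}, h =1 ev \o r.
  apply: leibniz_exists => [k u v|u v] /=.
    rewrite -{1}(rK u) -{1}(rK v).
    by rewrite -[k *: _]lclass_scale -[_ + _]lclass_add evE.
  by rewrite -{1}(rK u) -{1}(rK v) -[{[_, _]}]lclass_bracket evE.
by exists h => x; rewrite hE /= evE.
Qed.

(** Two preimages under [p] differ by an element of its kernel, which [f] kills, so [f] after any
    set-theoretic section of [p] is linear. *)
Lemma linear_factor (V Q W : lmodType K) (p : {linear V -> Q})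
    (f : {linear V -> W}) :
  (forall q, exists v, p v = q) -> (forall v, p v = 0 -> f v = 0) ->
  exists h : {linear Q -> W}, forall v, h (p v) = f v.
Proof.
move=> p_surj ker_sub; have [r rK] := choice p_surj.
have frE v : f (r (p v)) = f v.
  by apply/eqP; rewrite -subr_eq0 -linearB ker_sub ?eqxx // linearB rK subrr.
have [h hE] : exists h : {linear Q -> W}, h =1 f \o r.
  apply: linear_exists => k u v /=.
  by rewrite -{1}(rK u) -{1}(rK v) -linearP frE linearP.
by exists h => v; rewrite hE /= frE.
Qed.

Lemma leibniz_factor (V Q W : leibnizType K) (p : {leibniz V -> Q})
    (f : {leibniz V -> W}) :
  (forall q, exists v, p v = q) -> (forall v, p v = 0 -> f v = 0) ->
  exists h : {leibniz Q -> W}, forall v, h (p v) = f v.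
Proof.
move=> p_surj ker_sub; have [h hE] := @linear_factor V Q W p f p_surj ker_sub.
have [h' h'E] : exists h' : {leibniz Q -> W}, h' =1 h.
  apply: leibniz_exists => [|x y]; first exact: linearP.
  have [u <-] := p_surj x; have [v <-] := p_surj y.
  by rewrite -bracket_morph !hE -bracket_morph.
by exists h' => v; rewrite h'E hE.
Qed.

Lemma span_sub_ker (V W : lmodType K) (G : V -> Prop) (f : {linear V -> W}) :
  (forall v, G v -> f v = 0) -> forall v, v \in span G -> f v = 0.
Proof.
move=> Gf v /asboolP; elim=> [|k u w Gu _ IH]; first exact: linear0.
by rewrite linearP Gf // IH scaler0 addr0.
Qed.

Lemma ideal_sub_ker (L W : leibnizType K) (G : L -> Prop)
    (f : {leibniz L -> W}) :
  (forall v, G v -> f v = 0) -> forall v, v \in ideal G -> f v = 0.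
Proof.
move=> Gf v /asboolP; elim=> {v}.
- exact: Gf.
- exact: linear0.
- by move=> k u v _ fu _ fv; rewrite linearP /= fu fv scaler0 addr0.
- by move=> x u _ fu; rewrite bracket_morph fu bracket0r.
- by move=> x u _ fu; rewrite bracket_morph fu bracket0l.
Qed.

Lemma modproj_eq0 (V : lmodType K) (S : submodClosed V) v :
  modproj S v = 0 <-> v \in S.
Proof.
by rewrite -(linear0 (modproj S)) modproj_eq subr0.
Qed.

Lemma modquot_lift (V W : lmodType K) (G : V -> Prop) (f : {linear V -> W}) :
  (forall v, G v -> f v = 0) ->
  exists h : {linear modquot (span G) -> W},
    forall v, h (modproj (span G) v) = f v.
Proof.
move=> Gf; apply: linear_factor => [q|v /modproj_eq0]; first exact: modproj_surj.
exact: span_sub_ker.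
Qed.

End UniversalProperties.

(** * Bilinear maps *)

Definition bilinear_map (K : comPzRingType) (U V W : lmodType K)
    (f : U -> V -> W) : Prop :=
  (forall k x y z, f (k *: x + y) z = k *: f x z + f y z) /\
  (forall k x y z, f x (k *: y + z) = k *: f x y + f x z).

Section BilinearMap.
Variables (K : comPzRingType) (U V W : lmodType K) (f : U -> V -> W).
Hypothesis f_bil : bilinear_map f.

Lemma bilinear0l y : f 0 y = 0.
Proof. by have := f_bil.1 (-1) 0 0 y; rewrite scaler0 addr0 scaleN1r addNr. Qed.
Lemma bilinear0r x : f x 0 = 0.
Proof. by have := f_bil.2 (-1) x 0 0; rewrite scaler0 addr0 scaleN1r addNr. Qed.
Lemma bilinearDl x x' y : f (x + x') y = f x y + f x' y.
Proof. by have := f_bil.1 1 x x' y; rewrite !scale1r. Qed.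
Lemma bilinearDr x y y' : f x (y + y') = f x y + f x y'.
Proof. by have := f_bil.2 1 x y y'; rewrite !scale1r. Qed.
Lemma bilinearZl k x y : f (k *: x) y = k *: f x y.
Proof. by have := f_bil.1 k x 0 y; rewrite bilinear0l !addr0. Qed.
Lemma bilinearZr k x y : f x (k *: y) = k *: f x y.
Proof. by have := f_bil.2 k x y 0; rewrite bilinear0r !addr0. Qed.
End BilinearMap.

(** * Coordinates in a free module *)

Section Coordinates.
Variables (K : comPzRingType) (A : lmodType K) (I : choiceType) (b : I -> A).
Hypothesis b_span :
  forall v, exists (s : seq I) (c : I -> K), v = \sum_(i <- s) c i *: b i.
Hypothesis b_free : forall (s : seq I) (c : I -> K), uniq s ->
  \sum_(i <- s) c i *: b i = 0 -> forall i, i \in s -> c i = 0.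

Lemma sum_support_widen (c : I -> K) (s t : seq I) :
  uniq s -> uniq t -> {subset s <= t} -> (forall i, i \notin s -> c i = 0) ->
  \sum_(i <- t) c i *: b i = \sum_(i <- s) c i *: b i.
Proof.
move=> us ut st c0; rewrite (bigID (mem s)) /= [X in _ + X]big1 ?addr0; last first.
  by move=> i /c0 ->; rewrite scale0r.
rewrite -big_filter; apply: perm_big; apply: uniq_perm => //.
  exact: filter_uniq.
move=> i; rewrite mem_filter; case si: (i \in s) => //=; exact: st.
Qed.

(** Coordinates are total functions vanishing off a finite list, so that vectors with different
    supports can be compared pointwise. *)
Definition has_coords (v : A) (c : I -> K) : Prop :=
  exists2 s, uniq s &
    (forall i, i \notin s -> c i = 0) /\ v = \sum_(i <- s) c i *: b i.

Lemma has_coords_linear k u v c d : has_coords u c -> has_coords v d ->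
  has_coords (k *: u + v) (fun i => k * c i + d i).
Proof.
move=> [s us [cs ->]] [t ut [dt ->]].
have uU := undup_uniq (s ++ t).
have mU i : (i \in undup (s ++ t)) = (i \in s) || (i \in t).
  by rewrite mem_undup mem_cat.
exists (undup (s ++ t)) => //; split=> [i|].
  by rewrite mU negb_or => /andP[/cs -> /dt ->]; rewrite mulr0 addr0.
rewrite -(@sum_support_widen c s (undup (s ++ t))) //; last first.
  by move=> i; rewrite mU => ->.
rewrite -(@sum_support_widen d t (undup (s ++ t))) //; last first.
  by move=> i; rewrite mU orbC => ->.
rewrite scaler_sumr -big_split /=; apply: eq_bigr => i _.
by rewrite scalerDl scalerA.
Qed.

Lemma has_coords0 : has_coords 0 (fun=> 0).
Proof. by exists [::] => //; rewrite big_nil. Qed.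

Lemma has_coords_basis i : has_coords (b i) (fun j => (j == i)%:R).
Proof.
exists [:: i] => //; split=> [j|]; first by rewrite inE => /negPf ->.
by rewrite big_seq1 eqxx scale1r.
Qed.

Lemma has_coords_total v : exists c, has_coords v c.
Proof.
have [s [c ->]] := b_span v.
elim: s => [|i s [d sd]]; first by rewrite big_nil; eexists; apply: has_coords0.
rewrite big_cons; eexists; apply: has_coords_linear sd; exact: has_coords_basis.
Qed.

(** The difference of two coordinate functions represents 0: freeness kills it on its support, and
    it is 0 elsewhere. Linearity of the coordinates follows from this uniqueness. *)
Lemma has_coords_inj v c d : has_coords v c -> has_coords v d -> c =1 d.
Proof.
move=> vc vd; have [s us [es]] := has_coords_linear (-1) vc vd.
rewrite scaleN1r addNr => /esym s0 i; apply/esym/eqP; rewrite -subr_eq0 addrC.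
rewrite -mulN1r; case si: (i \in s); first by apply/eqP/(b_free us s0).
by rewrite es // si.
Qed.

Lemma coordinates_exist : exists x : A -> I -> K,
  (forall k u v i, x (k *: u + v) i = k * x u i + x v i) /\
  (forall v, has_coords v (x v)).
Proof.
have [x xP] := choice has_coords_total; exists x; split=> // k u v i.
exact: has_coords_inj (xP _) (has_coords_linear k (xP u) (xP v)) i.
Qed.
End Coordinates.

(** * The universal quadratic functor *)

Section GammaTheory.
Variables (K : comPzRingType) (A : lmodType K).
Local Notation gamma := (@gamma K A).

Lemma gamma_relE u v : gamma_rel u v ->
  modproj (span (@gamma_relator K A)) u = modproj (span (@gamma_relator K A)) v.
Proof.
move=> r; apply/modproj_eq/asboolP; rewrite -[_ - _]scale1r -[_ *: _]addr0.
by apply: span_step; [exists u, v | apply: span_zero].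
Qed.

Lemma gammaZ k a : gamma (k *: a) = k ^+ 2 *: gamma a.
Proof. by have := gamma_relE (gamma_sq k a); rewrite linearZ => ->. Qed.

Lemma gamma0 : gamma 0 = 0.
Proof. by rewrite -[X in gamma X](scale0r 0) gammaZ expr0n scale0r. Qed.

(** The polar form of the quadratic map [gamma]. *)
Definition gamma_polar (a c : A) : Gamma A := gamma (a + c) - gamma a - gamma c.

Lemma gammaD a c : gamma (a + c) = gamma a + gamma_polar a c + gamma c.
Proof. by rewrite /gamma_polar -addrA subrK addrC subrK. Qed.

Lemma gamma_polarC a c : gamma_polar a c = gamma_polar c a.
Proof. by rewrite /gamma_polar [c + a]addrC addrAC. Qed.

Lemma gamma_polarDl a a' c :
  gamma_polar (a + a') c = gamma_polar a c + gamma_polar a' c.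
Proof.
have := gamma_relE (gamma_add3 a a' c); rewrite !linearD /= -!/(gamma _).
move/(congr1 (fun z => z - gamma c - gamma a' - gamma a)); rewrite !addrK => e.
rewrite /gamma_polar e !addrA [LHS](ACl (2*6*4*3*5*8*(1*7)))%AC /=.
by rewrite subrr addr0.
Qed.

Lemma gamma_polarZl k a c : gamma_polar (k *: a) c = k *: gamma_polar a c.
Proof.
have := gamma_relE (gamma_lin k a c).
rewrite /gamma_polar !(linearD, linearZ) /= -!/(gamma _).
move=> /(congr1 (fun z => z - k *: gamma c - k *: gamma a)); rewrite !addrK => e.
rewrite !scalerN e [LHS](ACl (1*5*4*(2*6)*(3*7)))%AC /=.
by rewrite !subrr !addr0.
Qed.

Lemma gamma_polar_bilinear : bilinear_map gamma_polar.
Proof.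
split=> k x y z; first by rewrite gamma_polarDl gamma_polarZl.
by rewrite ![gamma_polar x _]gamma_polarC gamma_polarDl gamma_polarZl.
Qed.

(* The recursion sums over the pairs of positions [i <= j] in [s], so that the
   diagonal recovers the expansion of [gamma] of a linear combination without
   ordering the basis. *)
Lemma gamma_diagonal (I : eqType) (b : I -> A) (x : A -> I -> K) (s : seq I) :
  (forall k u v i, x (k *: u + v) i = k * x u i + x v i) ->
  exists2 r : A -> A -> Gamma A, bilinear_map r &
    forall a, r a a = gamma (\sum_(i <- s) x a i *: b i).
Proof.
move=> xP; elim: s => [|i s [r r_bil rE]].
  exists (fun _ _ => 0); last by move=> a; rewrite big_nil gamma0.
  by split=> *; rewrite scaler0 addr0.
pose p a := \sum_(j <- s) x a j *: b j.
have pP k u v : p (k *: u + v) = k *: p u + p v.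
  rewrite /p scaler_sumr -big_split; apply: eq_bigr => j _ /=.
  by rewrite xP scalerDl scalerA.
(* The polar form is hidden behind [q], so that only its bilinearity and the expansion of [gamma] of
   a sum are used. *)
have [q q_bil qE] : exists2 q : A -> A -> Gamma A, bilinear_map q &
    forall a c, gamma (a + c) = gamma a + q a c + gamma c.
  exact: ex_intro2 gamma_polar_bilinear gammaD.
have [ql qr] := q_bil; have [rl rr] := r_bil.
(* Polarises gamma(x_i b_i + p) = x_i^2 gamma(b_i) + x_i q(b_i, p) + gamma(p), with [r] handling the
   tail. *)
exists (fun a a' => (x a i * x a' i) *: gamma (b i)
                    + x a i *: q (b i) (p a') + r a a').
  split=> k u v w; rewrite ?rl ?rr xP ?pP ?qr.
    by rewrite mulrDl -mulrA !scalerDl -!scalerA !scalerDr !addrA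
      [LHS](ACl (1*3*5*2*4*6))%AC.
  rewrite mulrDr mulrCA !scalerDl !scalerDr !scalerA [x u i * k]mulrC !addrA.
  by rewrite [LHS](ACl (1*3*5*2*4*6))%AC.
move=> a; rewrite rE big_cons qE gammaZ expr2.
by rewrite (bilinearZl q_bil).
Qed.

Lemma Gamma_ind (P : Gamma A -> Prop) :
  (forall a, P (gamma a)) -> P 0 ->
  (forall k u v, P u -> P v -> P (k *: u + v)) -> forall u, P u.
Proof.
move=> Pg P0 PL q; have [u <-] := modproj_surj q.
elim/freemod_ind: u => [a||k u v Pu Pv]; first exact: Pg.
  by rewrite linear0.
by rewrite linearP; apply: PL.
Qed.

(** An element of [Gamma A] involves finitely many [gamma a], each [a] with finite support; on a
    list [t] containing all these supports truncation changes nothing. This lets injectivity be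
    tested with finite lists of basis vectors. *)
Lemma Gamma_finite_support (I : choiceType) (b : I -> A) (x : A -> I -> K) :
  (forall a, has_coords b a (x a)) ->
  forall w : Gamma A, exists2 s : seq I, uniq s &
    forall t : seq I, uniq t -> {subset s <= t} ->
    forall h : {linear Gamma A -> Gamma A},
      (forall a, h (gamma a) = gamma (\sum_(i <- t) x a i *: b i)) -> h w = w.
Proof.
move=> xP; elim/Gamma_ind=> [a||k u v [s us su] [s' us' sv]].
- have [s us [x0 aE]] := xP a; exists s => // t ut st h ->.
  by rewrite {2}aE (sum_support_widen _ us).
- by exists [::] => // t _ _ h _; rewrite linear0.
- exists (undup (s ++ s')) => [|t ut st h hE]; first exact: undup_uniq.
  rewrite linearP (su t) ?(sv t) // => i si; apply: st;
    by rewrite mem_undup mem_cat si ?orbT.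
Qed.

(** The diagonal of a bilinear map is quadratic, hence satisfies the relations of [gamma]. *)
Lemma Gamma_lift (W : lmodType K) (f : A -> A -> W) : bilinear_map f ->
  exists h : {linear Gamma A -> W}, forall a, h (gamma a) = f a a.
Proof.
move=> fb; have [h0 h0E] := freemod_lift (fun a => f a a).
have [|h hE] := @modquot_lift K _ _ (@gamma_relator K A) h0.
  move=> _ [u [v [r ->]]]; rewrite linearB; apply/eqP; rewrite subr_eq0.
  apply/eqP; case: r => [k a|a c e|k a c]; rewrite ?(linearD, linearZ) /= !h0E.
  - by rewrite (bilinearZl fb) (bilinearZr fb) scalerA expr2.
  - rewrite !(bilinearDl fb) !(bilinearDr fb) !addrA.
    by rewrite [LHS](ACl (1*2*4*5*10*3*7*9*11*6*8*12))%AC.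
  - rewrite !(bilinearDl fb) !(bilinearDr fb) !(bilinearZl fb) !(bilinearZr fb) !scalerDr !addrA.
    by rewrite [LHS](ACl (5*2*3*6*1*4))%AC.
by exists h => a; rewrite hE h0E.
Qed.
End GammaTheory.

(** * The exterior square of a module *)

Section WedgeTheory.
Variables (K : comPzRingType) (A : lmodType K).

Lemma wedge_relE u v : wedge_rel u v ->
  modproj (span (@wedge_relator K A)) u = modproj (span (@wedge_relator K A)) v.
Proof.
move=> r; apply/modproj_eq/asboolP; rewrite -[_ - _]scale1r -[_ *: _]addr0.
by apply: span_step; [exists u, v | apply: span_zero].
Qed.

Lemma wedge_bilinear : bilinear_map (@wedge K A).
Proof.
split=> k x y z.
  by have := wedge_relE (wedge_linearl k x y z); rewrite linearP.
by have := wedge_relE (wedge_linearr k x y z); rewrite linearP.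
Qed.

Lemma wedgexx a : wedge a a = 0 :> ExtSquare A.
Proof. by have := wedge_relE (wedge_alt a); rewrite linear0. Qed.
End WedgeTheory.

(** * Maps out of the tensor square, and the diagonal differences *)

Section TensorSquareTheory.
Variables (K : comPzRingType) (g : leibnizType K).
Local Notation A := (abelianization g).
Local Notation T := (tensor_square g).

Lemma abclass_linear k (x y : g) :
  abclass (k *: x + y) = k *: abclass x + abclass y.
Proof. exact: linearP. Qed.

Lemma abclass_surj (a : A) : exists c : g, abclass c = a.
Proof. exact: modproj_surj. Qed.

Lemma abclass_bracket (x y : g) : abclass {[x, y]} = 0.
Proof.
apply/modproj_eq0/asboolP; rewrite -[{[_, _]}]scale1r -[_ *: _]addr0.
by apply: span_step; [exists x, y | apply: span_zero].
Qed.

Lemma tensor_square_lift (W : leibnizType K) (f : A -> A -> W) :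
  (forall u v : W, {[u, v]} = 0) -> bilinear_map f ->
  exists h : {leibniz T -> W},
    (forall x y, h (star1 x y) = f (abclass x) (abclass y)) /\
    (forall x y, h (star2 x y) = 0).
Proof.
move=> W0 fb.
have [h0 h0E] := @freeleib_lift K (star_symbol g) W (fun s =>
  match s with Star1 x y => f (abclass x) (abclass y) | Star2 _ _ => 0 end).
have h0B u v : h0 {[u, v]} = 0 by rewrite bracket_morph W0.
have [||h hE] :=
    @leibniz_factor K _ _ _ (leibproj (ideal (@star_relator K g))) h0.
- exact: leibproj_surj.
- move=> v /modproj_eq0; apply: ideal_sub_ker => {v} _ [u [v [r ->]]].
  rewrite linearB; apply/eqP; rewrite subr_eq0; apply/eqP.
  by case: r => *; rewrite ?(linearD, linearN, linearZ) /= ?h0E ?h0B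
       ?abclass_linear ?abclass_bracket ?fb.1 ?fb.2
       ?(bilinear0l fb) ?(bilinear0r fb) ?scaler0 ?subrr ?oppr0 ?addr0.
by exists h; split=> x y; rewrite hE h0E.
Qed.

Definition diag (x y : g) : T := star1 x y - star2 x y.

Lemma diag_bilinear : bilinear_map diag.
Proof.
rewrite /diag; split=> k x y z.
  have := star_relE (star1_linearl k x y z).
  have := star_relE (star2_linearl k x y z).
  rewrite !linearP -/(star2 _ _) -/(star1 _ _) => /= -> ->.
  by rewrite scalerBr opprD addrACA.
have := star_relE (star1_linearr k x y z).
have := star_relE (star2_linearr k x y z).
rewrite !linearP -/(star2 _ _) -/(star1 _ _) => /= -> ->.
by rewrite scalerBr opprD addrACA.
Qed.

(** Expanding [a *1 {[c, y]}] by [star1_bracketr] in the [star1_bracketl] relation for [{[a, y]} *1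
    c] cancels that symbol and leaves [{[a, c]} *1 y = {[a, c]} *2 y]. *)
Lemma diag_bracketl (a c y : g) : diag {[a, c]} y = 0.
Proof.
have := star_relE (star1_bracketl a y c); have := star_relE (star1_bracketr a c y).
rewrite !linearB /= -!/(star1 _ _) -!/(star2 _ _) => ->.
rewrite opprB addrCA -[X in X = _]addr0 => /addrI/esym e.
by rewrite /diag -opprB e oppr0.
Qed.

(** Subtracting the two right-bracket relations gives [diag {[x, a]} c - diag {[x, c]} a], where
    both terms vanish. *)
Lemma diag_bracketr (x a c : g) : diag x {[a, c]} = 0.
Proof.
have := star_relE (star1_bracketr x a c).
have := star_relE (star2_bracketr x a c).
rewrite !linearB /= -!/(star1 _ _) -!/(star2 _ _) /diag => -> ->.
rewrite opprD addrACA -opprD.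
have := diag_bracketl x a c; have := diag_bracketl x c a.
by rewrite /diag => -> ->; rewrite oppr0 addr0.
Qed.

Lemma diag_descends : exists2 D : A -> A -> T, bilinear_map D &
  forall x y, D (abclass x) (abclass y) = diag x y.
Proof.
have [sec secK] := choice abclass_surj.
have [dl dr] := diag_bilinear.
have diag_eq x x' y y' : abclass x = abclass x' -> abclass y = abclass y' ->
    diag x y = diag x' y'.
  (* One argument is changed at a time: with the other fixed, [diag] is a linear map that kills the
     span of the brackets. *)
  move=> /modproj_eq ex /modproj_eq ey; transitivity (diag x' y).
    have [L LE] := @linear_exists K g T (diag^~ y) (fun k u v => dl k u v y).
    apply/eqP; rewrite -subr_eq0 -!LE -linearB; apply/eqP.
    by apply: span_sub_ker ex => _ [a [c ->]]; rewrite LE diag_bracketl.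
  have [L LE] := @linear_exists K g T (diag x') (fun k u v => dr k x' u v).
  apply/eqP; rewrite -subr_eq0 -!LE -linearB; apply/eqP.
  by apply: span_sub_ker ey => _ [a [c ->]]; rewrite LE diag_bracketr.
exists (fun a c => diag (sec a) (sec c)); last first.
  by move=> x y; apply: diag_eq; rewrite secK.
split=> k x y z; rewrite -?dl -?dr; apply: diag_eq => //.
all: by rewrite abclass_linear !secK.
Qed.

Lemma diag_map_injective (psi : {linear Gamma A -> T}) :
  free_module A -> (forall c : g, psi (gamma (abclass c)) = diag c c) ->
  injective psi.
Proof.
move=> [I [b [b_span b_free]]] psiE.
have [x [x_lin xP]] := coordinates_exist b_span b_free.
suff psi0 w : psi w = 0 -> w = 0.
  by move=> u v /eqP; rewrite -subr_eq0 -linearB => /eqP/psi0/eqP;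
     rewrite subr_eq0 => /eqP.
have [s us sw] := Gamma_finite_support xP w.
have [r r_bil rE] := gamma_diagonal b s x_lin.
have [||th [th1 th2]] := @tensor_square_lift (Gamma A) r => //.
have [h hE] : exists h : {linear Gamma A -> Gamma A}, h =1 th \o psi.
  by apply: linear_exists => k u v /=; rewrite !linearP.
(* [h] sends [gamma a] to [r a a], the [gamma] of the truncation of [a] to [s], so it fixes [w]; but
   it factors through [psi w = 0]. *)
move=> w0; rewrite -(sw s us _ h) // => [|a]; rewrite hE /= ?w0 ?linear0 //.
have [c <-] := abclass_surj a.
by rewrite psiE linearB /= th1 th2 subr0 rE.
Qed.

Lemma exterior_proj_eq0 (z : T) :
  exterior_proj g z = 0 <-> z \in span (@diagonal_gen K g).
Proof. exact: modproj_eq0. Qed.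

End TensorSquareTheory.

(** * Construction of the maps and exactness *)

Theorem proposition5p10 (K : comPzRingType) (g : leibnizType K)
    (hfree : free_module (abelianization g)) :
  exists (psi : {leibniz Gamma (abelianization g) -> tensor_square g})
         (tau : {leibniz tensor_square g -> ExtSquare (abelianization g)}),
    [/\ forall c : g, psi (gamma (abclass c)) = star1 c c - star2 c c,
        forall x y : g, tau (star1 x y) = wedge (abclass x) (abclass y),
        forall x y : g, tau (star2 x y) = 0
      & short_exact psi (pair_mor (exterior_proj g) tau)].
Proof.
set A := abelianization g.
have [D D_bil DE] := diag_descends g.
have [psi0 psi0E] := Gamma_lift D_bil.
have [||tau [tau1 tau2]] :=
  @tensor_square_lift K g (ExtSquare A) (@wedge K A) => //.
  exact: wedge_bilinear.
have diag_central (c c' : g) u : {[diag c c', u]} = 0 /\ {[u, diag c c']} = 0.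
  by apply: diagonal_gen_central; exists c, c'.
have psi0_diag (c : g) : psi0 (gamma (abclass c)) = diag c c by rewrite psi0E DE.
(* [Gamma A] has zero bracket, so [psi0] respects brackets once brackets of its values vanish. *)
have psi0_central u v : {[psi0 u, v]} = 0.
  elim/Gamma_ind: u => [a||k u u' Pu Pu'].
  - by have [c <-] := abclass_surj a; rewrite psi0_diag (diag_central c c v).1.
  - by rewrite linear0 bracket0l.
  - by rewrite linearP bracket_linearl Pu Pu' scaler0 addr0.
have [psi psiE] : exists psi : {leibniz Gamma A -> tensor_square g}, psi =1 psi0.
  apply: leibniz_exists => [|u v]; first exact: linearP.
  by rewrite psi0_central linear0.
have tau_diag (x y : g) : tau (diag x y) = wedge (abclass x) (abclass y).
  by rewrite linearB /= tau1 tau2 subr0.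
have proj_diag (x y : g) : exterior_proj g (diag x y) = 0.
  apply/exterior_proj_eq0/asboolP; rewrite -[diag _ _]scale1r -[_ *: _]addr0.
  by apply: span_step; [exists x, y | apply: span_zero].
(* The free module on pairs stands in for the tensor product of [A] with itself: [tau] after [F] is
   the presentation of the exterior square, and the image of [F] dies under the projection. *)
have [F FE] := freemod_lift (fun p : A * A => D p.1 p.2).
have F_tau t : tau (F t) = modproj (span (@wedge_relator K A)) t.
  elim/freemod_ind: t => [[a c]||k u v Pu Pv].
  - have [x <-] := abclass_surj a; have [y <-] := abclass_surj c.
    by rewrite FE DE tau_diag.
  - by rewrite !linear0.
  - by rewrite !linearP /= Pu Pv.
have F_proj t : exterior_proj g (F t) = 0.
  elim/freemod_ind: t => [[a c]||k u v Pu Pv].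
  - have [x <-] := abclass_surj a; have [y <-] := abclass_surj c.
    by rewrite FE DE proj_diag.
  - by rewrite !linear0.
  - by rewrite !linearP /= Pu Pv scaler0 addr0.
exists psi, tau; split=> [c|//|//|].
  by rewrite psiE psi0_diag.
split.
- move=> u v; rewrite !psiE; exact: diag_map_injective.
- move=> z; split; last first.
    move=> [u <-]; rewrite psiE.
    elim/Gamma_ind: u => [a||k u v Pu Pv]; rewrite ?linear0 //; last first.
      by rewrite 2!linearP /= Pu Pv scaler0 addr0.
    have [c <-] := abclass_surj a.
    by rewrite psi0_diag; congr pair; rewrite ?proj_diag // tau_diag wedgexx.
  move=> [/exterior_proj_eq0 z_diag tau_z].
  (* The kernel of the projection is spanned by the values of [D]. *)
  have [t tE] : exists t, F t = z.
    move/asboolP: z_diag; elim=> [|k u v [c [c' ->]] _ [t <-]].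
      by exists 0; rewrite linear0.
    exists (k *: mgen K (abclass c, abclass c') + t).
    by rewrite linearP FE DE.
  (* Now [t] is a combination of wedge relators; [F] kills the bilinearity ones and sends the
     alternating one at [a] to [psi (gamma a)]. *)
  move: tau_z; rewrite -tE F_tau => /modproj_eq0/asboolP.
  elim=> [|k _ v [u [u' [r ->]]] _ [w wE]]; first by exists 0; rewrite !linear0.
  have [w' w'E] : exists w', psi w' = F (u - u').
    rewrite linearB; case: r => [l a a' c|l a c c'|a].
    - by exists 0; rewrite linearP !FE D_bil.1 subrr linear0.
    - by exists 0; rewrite linearP !FE D_bil.2 subrr linear0.
    - by exists (gamma a); rewrite linear0 FE subr0 psiE psi0E.
  by exists (k *: w' + w); rewrite !linearP /= w'E wE.
- move=> [p w].
  have [y yE] := leibproj_surj p.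
  have [t tE] := modproj_surj (w - tau y).
  (* [F t] corrects the wedge component of [y] without changing its exterior component. *)
  exists (y + F t); congr pair; first by rewrite linearD /= F_proj addr0.
  by rewrite linearD /= F_tau tE addrC subrK.
Qed.
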